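(* Let $n\ge 3$ be an integer and let $A$ be an abelian group of order $2^n$ whose exponent is $2$ or $4$. Then there exists an $A$-reversible $\mathrm{SQS}(2^n)$.
   Context: An $\mathrm{SQS}(v)$ on a point set $V$ of size $v$ is a family of $4$-subsets (blocks) of $V$ such that every $3$-subset of $V$ lies in exactly one block. For a finite abelian group $A$ (additive), let $\hat A$ be the permutation group on $A$ generated by translations $x\mapsto x+a$ and $x\mapsto -x$. A subset $B\subseteq A$ is symmetric if $B=-B+x$ for some $x\in A$. An $\mathrm{SQS}(|A|)$ with point set $A$ is $A$-reversible if every block is symmetric and the set of blocks is invariant under $\hat A$. *)

(* Defs.v *)
From HB Require Import structures.
From mathcomp Require Import all_boot all_algebra all_fingroup all_solvable.

Set Implicit Arguments.
Unset Strict Implicit.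
Unset Printing Implicit Defensive.

Import GRing.Theory.
Local Open Scope ring_scope.

Definition is_SQS (v : nat) (V : finType) (Bs : {set {set V}}) : Prop :=
  [/\ #|V| = v,
      forall B : {set V}, B \in Bs -> #|B| = 4%N
    & forall S : {set V}, #|S| = 3%N ->
        exists! B : {set V}, B \in Bs /\ S \subset B].

Definition translation (A : finZmodType) (a : A) : {perm A} := perm (addIr a).

Definition negation (A : finZmodType) : {perm A} := perm (@oppr_inj A).

Definition hat (A : finZmodType) : {group {perm A}} :=
  <<[set translation a | a : A] :|: [set negation A]>>%G.

Definition symmetric_set (A : finZmodType) (B : {set A}) : Prop :=
  exists x : A, B = [set - b + x | b in B].

Definition is_reversible_SQS (v : nat) (A : finZmodType) (Bs : {set {set A}}) :
    Prop :=
  [/\ is_SQS v Bs,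
      forall B : {set A}, B \in Bs -> symmetric_set B
    & forall (g : {perm A}) (B : {set A}),
        g \in hat A -> B \in Bs -> [set g x | x in B] \in Bs].

(* Main.v *)
Require Import Defs.
From mathcomp Require Import all_boot all_algebra all_fingroup all_solvable.

(** Write [D(B)] for the set of doubled differences [2(u - v)] of points of [B],
    and [d(B)] for a chosen nonzero element of [D(B)], or [0] when there is none.
    The blocks are the 4-sets [B] whose sum is [d(B)].  As [4A = 0], the sum of a
    block is killed by 2, so [2w = 2x + 2y + 2z] in a block [{x, y, z, w}] and
    [D(B)] is already determined by [{x, y, z}]; hence so is [w].  Moreover
    [d(B) = 2(u - v) = 2u + 2v] for some distinct [u, v] in [B], so the other two
    points have sum [u + v], and [B] is stable under [b |-> u + v - b]. *)

Section QuadrupleSystem.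

Set Implicit Arguments.
Unset Strict Implicit.
Unset Printing Implicit Defensive.

Import GRing.Theory.
Local Open Scope ring_scope.

Variable A : finZmodType.
Implicit Types (a b : A) (B S : {set A}).

Definition double_diffs B : {set A} := [set (u - v) *+ 2 | u in B, v in B].

(** The choice reads [B] only through [double_diffs B], so sets with equal doubled differences have
    equal directions. *)
Definition direction B : A := odflt 0 [pick e in double_diffs B | e != 0].

Definition blocks : {set {set A}} :=
  [set B : {set A} | (#|B| == 4%N) && (\sum_(b in B) b == direction B)].

(** If the direction is [0], all doubled differences vanish and any two distinct points serve. *)
Lemma direction_witness S : (1 < #|S|)%N ->
  exists u v, [/\ u \in S, v \in S, u != v & direction S = (u - v) *+ 2].
Proof.
rewrite /direction => S_gt1; case: pickP => [e | no_dir] /=.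
  case/andP=> /imset2P[u v uS vS ->] nz; exists u, v; split=> //.
  by apply: contraNneq nz => ->; rewrite subrr mul0rn.
case/card_gt1P: S_gt1 => u [v] [uS vS neq_uv]; exists u, v; split=> //.
have := no_dir ((u - v) *+ 2); rewrite (imset2_f _ uS vS) /=.
by move/negbFE/eqP.
Qed.

Lemma direction_eq0 S u v :
  direction S = 0 -> u \in S -> v \in S -> (u - v) *+ 2 = 0.
Proof.
rewrite /direction; case: pickP => [e /andP[_ nz] /= e0 | no_dir _ uS vS].
  by rewrite e0 eqxx in nz.
by have := no_dir ((u - v) *+ 2); rewrite (imset2_f _ uS vS) /= => /negbFE/eqP.
Qed.

Lemma double_diffs_translation a B :
  double_diffs [set b + a | b in B] = double_diffs B.
Proof.
apply/setP=> e; apply/imset2P/imset2P=> [|[u v uB vB ->]].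
  case=> _ _ /imsetP[u uB ->] /imsetP[v vB ->] ->.
  by exists u v; rewrite // opprD addrACA subrr addr0.
exists (u + a) (v + a); try exact: (imset_f (+%R^~ a)).
by rewrite opprD addrACA subrr addr0.
Qed.

Lemma double_diffs_opp B : double_diffs [set - b | b in B] = double_diffs B.
Proof.
apply/setP=> e; apply/imset2P/imset2P=> [|[u v uB vB ->]].
  case=> _ _ /imsetP[u uB ->] /imsetP[v vB ->] ->.
  by exists v u; rewrite // opprK addrC.
by exists (- v) (- u); rewrite ?imset_f // opprK addrC.
Qed.

Lemma set3_of_pair S u v : #|S| = 3%N -> u \in S -> v \in S -> u != v ->
  exists t, [/\ S = [set u; v; t], \sum_(b in S) b = u + (v + t), u != t
    & v != t].
Proof.
move=> S3 uS vS neq_uv.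
have vSu : v \in S :\ u by rewrite !inE eq_sym neq_uv.
have /cards1P[t St] : #|(S :\ u) :\ v| == 1%N.
  by move: S3; rewrite (cardsD1 u) uS (cardsD1 v (S :\ u)) vSu !add1n => -[->].
have: t \in (S :\ u) :\ v by rewrite St set11.
rewrite !inE => /and3P[neq_tv neq_tu _]; exists t.
split; rewrite 1?eq_sym //.
  by rewrite -(setD1K uS) -(setD1K vSu) St setUA.
by rewrite (big_setD1 u) //= (big_setD1 v) //= St big_set1.
Qed.

Lemma set4_of_pair B u v : #|B| = 4%N -> u \in B -> v \in B -> u != v ->
  exists p q, B = [set u; v; p; q] /\ \sum_(b in B) b = u + (v + (p + q)).
Proof.
move=> B4 uB vB neq_uv.
have vBu : v \in B :\ u by rewrite !inE eq_sym neq_uv.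
have /cards2P[p [q [neq_pq Bpq]]] : #|(B :\ u) :\ v| == 2%N.
  by move: B4; rewrite (cardsD1 u) uB (cardsD1 v (B :\ u)) vBu !add1n => -[->].
exists p, q; split; first by rewrite -(setD1K uB) -(setD1K vBu) Bpq !setUA.
by rewrite (big_setD1 u) //= (big_setD1 v) //= Bpq big_setU1 ?inE // big_set1.
Qed.

Hypothesis exp4 : forall a, a *+ 4 = 0.

Lemma double_opp a : - (a *+ 2) = a *+ 2.
Proof. by apply/eqP; rewrite eq_sym -addr_eq0 -mulrnDr exp4. Qed.

Lemma direction_double B : direction B *+ 2 = 0.
Proof.
rewrite /direction; case: pickP => [e | _] /=; last by rewrite mul0rn.
by case/andP=> /imset2P[u v _ _ ->]; rewrite -mulrnA exp4.
Qed.

(** Doubled elements are their own negatives. So for [S = {u, v, t}] and the added point [w],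
    [2(w - u) = 2(v + t) = 2(t - v)] is already a doubled difference of [S]. Leaving [e] free covers
    both the direction of [S] (existence) and that of an unknown block through [S] (uniqueness). *)
Lemma double_diffs_completion S e : #|S| = 3%N -> e *+ 2 = 0 ->
  double_diffs ((e - \sum_(b in S) b) |: S) = double_diffs S.
Proof.
move=> S3 e2; set w := e - _.
have wS u : u \in S -> (w - u) *+ 2 \in double_diffs S.
  move=> uS; have [v vS neq_uv] : exists2 v, v \in S & u != v.
    have: (0 < #|S :\ u|)%N by move: S3; rewrite (cardsD1 u) uS add1n => -[->].
    by case/card_gt0P=> v /setD1P[neq_vu vS]; exists v; rewrite // eq_sym.
  have [t [defS sumS neq_ut neq_vt]] := set3_of_pair S3 uS vS neq_uv.
  have tS : t \in S by rewrite defS !inE eqxx orbT.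
  suff -> : (w - u) *+ 2 = (t - v) *+ 2 by apply: imset2_f.
  rewrite /w sumS -addrA -opprD mulrnDl e2 add0r.
  rewrite mulNrn double_opp addrAC mulrnDl.
  by rewrite -mulr2n -mulrnA exp4 add0r mulrnBl double_opp addrC mulrnDl.
apply/eqP; rewrite eqEsubset andbC imset2S ?subsetUr //=.
apply/subsetP=> _ /imset2P[p q pB qB ->].
case/setU1P: pB qB => [-> | pS] /setU1P[-> | qS]; last exact: imset2_f.
- have /card_gt0P[u uS] : (0 < #|S|)%N by rewrite S3.
  by rewrite subrr -(subrr u); apply: imset2_f.
- exact: wS.
- by rewrite -double_opp -mulNrn opprB wS.
Qed.

(** Since [direction S = 2(u - v) = 2(u + v)], the completing point is [u + v - t]; it equals [u] or
    [v] only if [t] is [v] or [u]. *)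
Lemma completion_notin S : #|S| = 3%N ->
  direction S - \sum_(b in S) b \notin S.
Proof.
move=> S3; have [|u [v [uS vS neq_uv dE]]] := @direction_witness S.
  by rewrite S3.
have [t [defS sumS neq_ut neq_vt]] := set3_of_pair S3 uS vS neq_uv.
have tS : t \in S by rewrite defS !inE eqxx orbT.
have dD : direction S = (u + v) *+ 2 by rewrite dE mulrnBl double_opp -mulrnDl.
have -> : direction S - \sum_(b in S) b = u + v - t.
  by rewrite dD sumS mulr2n [u + (v + t)]addrA opprD addrA addrK.
apply/negP; rewrite {1}defS => /setUP[/set2P[]|/set1P] /eqP.
- by rewrite -addrA -subr_eq0 addrAC subrr add0r subr_eq0 (negPf neq_vt).
- by rewrite addrAC -subr_eq0 addrK subr_eq0 (negPf neq_ut).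
(* If it equals [t], then [u + v = 2t] and the direction is [4t = 0]; hence [2u = 2t = u + v],
   forcing [u = v]. *)
rewrite subr_eq -mulr2n => /eqP uvE.
have d0 : direction S = 0 by rewrite dD uvE -mulrnA exp4.
have := direction_eq0 d0 uS tS; rewrite mulrnBl -uvE mulr2n => /eqP.
rewrite opprD addrACA subrr add0r subr_eq0.
exact/negP.
Qed.

Lemma blocks_SQS : is_SQS #|A| blocks.
Proof.
split=> // [B | S S3]; first by rewrite inE => /andP[/eqP].
have wN := completion_notin S3.
exists ((direction S - \sum_(b in S) b) |: S); split.
  split; last exact: subsetUr.
  rewrite inE cardsU1 wN S3 /= big_setU1 //= subrK /direction.
  by rewrite (double_diffs_completion S3 (direction_double S)).
move=> B [/[1!inE] /andP[/eqP B4 /eqP sumB] sSB].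
have /cards1P[w Bw] : #|B :\: S| == 1%N by rewrite cardsDS // B4 S3.
have defB : B = w |: S by rewrite -(setID B S) (setIidPr sSB) Bw setUC.
have wS : w \notin S by have /setDP[] : w \in B :\: S by rewrite Bw set11.
have wE : w = direction B - \sum_(b in S) b.
  by rewrite -sumB defB big_setU1 //= addrK.
(* [B] and [S] have the same doubled differences, hence the same direction, which determines [w]. *)
have := double_diffs_completion S3 (direction_double B); rewrite -wE -defB.
by move=> DE; rewrite [RHS]defB wE /direction DE.
Qed.

Lemma blocks_symmetric B : B \in blocks -> symmetric_set B.
Proof.
rewrite inE => /andP[/eqP B4 /eqP sumB].
have [|u [v [uB vB neq_uv dE]]] := @direction_witness B; first by rewrite B4.
have [p [q [defB sumE]]] := set4_of_pair B4 uB vB neq_uv.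
have pqE : p + q = u + v.
  apply: (addrI (u + v)).
  by rewrite -addrA -sumE sumB dE mulrnBl double_opp -mulrnDl mulr2n.
(* The reflection swaps [u] with [v], and [p] with [q]. *)
exists (u + v); rewrite {2}defB !imsetU !imset_set1.
rewrite addKr [u + v]addrC addKr [v + u]addrC -pqE addKr [p + q]addrC addKr.
by rewrite defB -!setUA [RHS]setUCA [[set q] :|: _]setUC.
Qed.

Lemma blocks_hat (g : {perm A}) B :
  g \in hat A -> B \in blocks -> [set g x | x in B] \in blocks.
Proof.
(* The setwise stabilizer of [blocks] is a group, so checking the generators suffices. *)
have hat_acts : hat A \subset 'N(blocks | ('P^* )%act)%g.
  rewrite gen_subG; apply/subsetP=> h hh.
  rewrite !inE /=; apply/subsetP=> C; rewrite !inE /setact.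
  case/andP=> /eqP C4 /eqP sumC.
  rewrite card_imset ?C4 /=; last exact: perm_inj.
  rewrite big_imset /=; last by move=> ? ? _ _; apply: perm_inj.
  case/setUP: hh => [/imsetP[a _ ->] | /set1P->].
    under eq_bigr do rewrite apermE permE.
    under eq_imset => b do rewrite apermE permE.
    (* Translating the four points adds [4a = 0] to the sum. *)
    rewrite /direction double_diffs_translation big_split /= sumC sumr_const C4.
    by rewrite exp4 addr0.
  under eq_bigr do rewrite apermE permE.
  under eq_imset => b do rewrite apermE permE.
  (* Negation turns the sum [d] into [-d], which is [d] because [2d = 0]. *)
  rewrite sumrN sumC [in X in _ == X]/direction double_diffs_opp.
  by rewrite -/(direction C) eq_sym -addr_eq0 -mulr2n direction_double.
move=> gh Bb; have := astabs_act B (subsetP hat_acts g gh).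
by rewrite Bb.
Qed.

End QuadrupleSystem.

Theorem theorem5p5 (n : nat) (hn : 3 <= n) (A : finZmodType)
    (hA : #|A| = 2 ^ n)
    (hexp : exponent [set: A] = 2 \/ exponent [set: A] = 4) :
  exists Bs : {set {set A}}, is_reversible_SQS (2 ^ n) Bs.
Proof.
have exp4 (a : A) : (a *+ 4 = 0)%R.
  have : exponent [set: A] %| 4 by case: hexp => ->.
  by move/exponentP/(_ a (in_setT a)); rewrite FinRing.zmodXgE.
exists (blocks A); rewrite -hA; split.
- exact: blocks_SQS.
- exact: blocks_symmetric.
- exact: blocks_hat.
Qed.
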